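(* Let $X$ be a separable metric space and $f:X\to X$ a continuous map. Let $Z\subseteq X$ be closed and internally chain transitive. Then there exists an asymptotic pseudo-orbit $\langle x_i\rangle_{i\in\omega}$ of $f$, with $x_i\in Z$ for all $i$, such that $\omega\langle x_i\rangle=Z$.
   Context: Let $\omega=\{0,1,2,\dots\}$ and let $d$ be the metric on $X$. An asymptotic pseudo-orbit of $f$ is a sequence $\langle x_i\rangle_{i\in\omega}$ in $X$ with $d(f(x_i),x_{i+1})\to0$ as $i\to\infty$. For a sequence $\langle x_i\rangle$ in $X$, $\omega\langle x_i\rangle=\bigcap_{N\in\omega}\overline{\{x_i:i\ge N\}}$. For $\delta>0$, a $\delta$-chain from $a$ to $b$ is a finite sequence $x_0,x_1,\dots,x_n$ with $x_0=a$, $x_n=b$ and $d(f(x_i),x_{i+1})<\delta$ for all $i<n$. A set $A\subseteq X$ is internally chain transitive (ICT) if for all $a,b\in A$ and all $\delta>0$ there is a $\delta$-chain from $a$ to $b$ consisting of elements of $A$.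
   Formalization: Z is assumed nonempty (no sequence lies in the empty set), and δ-chains are required to have at least one step (n ≥ 1), since otherwise the singleton of a non-fixed point would be a closed internally chain transitive set for which the claim fails. *)

(* Defs.v *)
From HB Require Import structures.
From mathcomp Require Import all_boot all_order all_algebra.
From mathcomp Require Import all_classical all_reals all_analysis.

Set Implicit Arguments.
Unset Strict Implicit.
Unset Printing Implicit Defensive.

Import Order.TTheory GRing.Theory Num.Theory.
Import numFieldNormedType.Exports.

Local Open Scope classical_set_scope.
Local Open Scope ring_scope.

Definition separable_space (T : topologicalType) : Prop :=
  exists2 S : set T, countable S & dense S.

Definition asymptotic_pseudo_orbit (R : realType) (X : metricType R)
    (f : X -> X) (x : nat -> X) : Prop :=
  mdist (f (x i)) (x i.+1) @[i --> \oo] --> (0 : R).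

Definition omega_seq (T : topologicalType) (x : nat -> T) : set T :=
  \bigcap_(N in [set: nat]) closure [set x i | i in [set i | (N <= i)%N]].

(* The chain is x 0, ..., x n; the values of x beyond n are irrelevant.
   A chain has at least one step: if n = 0 were allowed, every singleton would
   be internally chain transitive, even that of a point not fixed by f. *)
Definition delta_chain (R : realType) (X : metricType R) (f : X -> X)
    (delta : R) (a b : X) (n : nat) (x : nat -> X) : Prop :=
  [/\ (0 < n)%N, x 0%N = a, x n = b &
      forall i : nat, (i < n)%N -> mdist (f (x i)) (x i.+1) < delta].

Definition internally_chain_transitive (R : realType) (X : metricType R)
    (f : X -> X) (A : set X) : Prop :=
  forall a b : X, A a -> A b -> forall delta : R, 0 < delta ->
  exists (n : nat) (x : nat -> X),
    delta_chain f delta a b n x /\ forall i : nat, (i <= n)%N -> A (x i).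

(* Main.v *)
(** The closed set [Z] inherits separability, so it contains a sequence [z]
    that returns infinitely often to every neighbourhood of every point of [Z].
    Join [z k] to [z k.+1] by a [1/(k+1)]-chain inside [Z] and concatenate
    these chains: the errors tend to [0], the limit points lie in [Z] because
    [Z] is closed, and each point of [Z] is a limit point because the
    concatenation visits every [z k]. *)

Require Import Defs.
From HB Require Import structures.
From mathcomp Require Import all_boot all_order all_algebra.
From mathcomp Require Import all_classical all_reals all_analysis.

Set Implicit Arguments.
Unset Strict Implicit.
Unset Printing Implicit Defensive.

Import Order.TTheory GRing.Theory Num.Theory.
Import numFieldNormedType.Exports.

Local Open Scope classical_set_scope.
Local Open Scope ring_scope.

(* [k] codes the pair of its 2-adic and 3-adic valuations; the factor
   [5 ^ N] yields arbitrarily large codes of the same pair. *)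
Lemma logn23_frequently (n m N : nat) :
  exists k : nat, [/\ (N <= k)%N, logn 2 k = n & logn 3 k = m].
Proof.
exists (2 ^ n * (3 ^ m * 5 ^ N))%N.
have gt0 p i : prime p -> (0 < p ^ i)%N.
  by move=> /prime_gt0 p0; rewrite expn_gt0 p0.
split.
- rewrite (leq_trans (ltnW (ltn_expl N (isT : 1 < 5)%N)))//.
  by rewrite mulnA leq_pmull// muln_gt0 !gt0.
- by rewrite !lognM ?muln_gt0 ?gt0// !lognX/= muln1 !muln0 !addn0.
- by rewrite !lognM ?muln_gt0 ?gt0// !lognX/= muln1 !muln0 addn0.
Qed.

(** A dense set may miss [Z], so each pair [(n, m)] is assigned a point of [Z] within [1/(m+1)] of
    the point of [S] numbered [n] by [g] if there is one, and the default [z0] otherwise. Listing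
    every pair infinitely often makes the approximations recur beyond any [N]. *)
Lemma separable_frequent_seq (R : realType) (X : metricType R) (Z : set X) :
  separable_space X -> Z !=set0 ->
  exists z : nat -> X, (forall k, Z (z k)) /\
    forall p, Z p -> forall e : R, 0 < e -> forall N : nat,
    exists2 k, (N <= k)%N & mdist p (z k) < e.
Proof.
move=> [S /countable_injP[g ginj] dS] [z0 Zz0].
pose near_code (n m : nat) (y : X) :=
  exists s, [/\ S s, g s = n & mdist s y < m.+1%:R^-1].
have /choice[w wP] : forall nm : nat * nat, exists y, Z y /\
    ((exists2 y', Z y' & near_code nm.1 nm.2 y') -> near_code nm.1 nm.2 y).
  move=> [n m]; have [[y Zy ny]|no] :=
    pselect (exists2 y', Z y' & near_code n m y'); first by exists y.
  by exists z0.
exists (fun k => w (logn 2 k, logn 3 k)); split=> [k|p Zp e e0 N].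
  by have [] := wP (logn 2 k, logn 3 k).
have e20 : 0 < e / 2 by rewrite divr_gt0.
have [m] := ltr_add_invr e20; rewrite add0r => me.
have m0 : 0 < m.+1%:R^-1 :> R by rewrite invr_gt0 ltr0n.
have [s [ps Ss]] : (ball p m.+1%:R^-1)° `&` S !=set0.
  apply: dS; last exact: open_interior.
  by exists p; apply: nbhsx_ballx.
have {}ps : mdist p s < m.+1%:R^-1.
  by move: (interior_subset ps); rewrite ballEmdist.
have [k [Nk k2 k3]] := logn23_frequently (g s) m N.
exists k => //; rewrite k2 k3.
have [_ /= []] := wP (g s, m).
  by exists p => //; exists s; split=> //; rewrite metric_sym.
move=> s' [Ss' /ginj]; rewrite !inE => /(_ Ss' Ss) -> sw.
rewrite (le_lt_trans (metric_triangle _ s _))// [ltRHS]splitr ltrD//.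
- exact: lt_trans ps me.
- exact: lt_trans sw me.
Qed.

Section concatenation.
Variables (T : Type) (c : nat -> nat -> T) (L : nat -> nat).
Hypothesis L_gt0 : forall k, (0 < L k)%N.

(* The block and the offset in that block of the current point. *)
Definition concat_step (s : nat * nat) : nat * nat :=
  if (s.2.+1 < L s.1)%N then (s.1, s.2.+1) else (s.1.+1, 0%N).

Definition concat_pos (t : nat) : nat * nat := iter t concat_step (0%N, 0%N).

Definition concat_seq (t : nat) : T := c (concat_pos t).1 (concat_pos t).2.

Lemma concat_pos_lt t : ((concat_pos t).2 < L (concat_pos t).1)%N.
Proof.
case: t => [|t]; first exact: L_gt0.
by rewrite /concat_pos iterS /concat_step; case: ifP => //= _; exact: L_gt0.
Qed.

Lemma concat_pos_nondecreasing t u :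
  (t <= u)%N -> ((concat_pos t).1 <= (concat_pos u).1)%N.
Proof.
move=> /subnK <-; elim: (u - t)%N => [//|n]; move/leq_trans; apply.
by rewrite addSn /concat_pos iterS /concat_step; case: ifP => //= _.
Qed.

(** Block [k] lasts exactly [L k] steps, hence at least one, so by induction block [k] starts no
    earlier than time [k]. *)
Lemma concat_pos_reach k : exists2 t, (k <= t)%N & concat_pos t = (k, 0%N).
Proof.
elim: k => [|k [t kt tk]]; first by exists 0%N.
have pos i : (i < L k)%N -> concat_pos (i + t) = (k, i).
  elim: i => [//|i IH] iL.
  rewrite addSn /concat_pos iterS -/(concat_pos _) IH ?(ltnW iL)//.
  by rewrite /concat_step/= iL.
exists (L k + t)%N.
  by rewrite -add1n leq_add.
rewrite -(prednK (L_gt0 k)) addSn /concat_pos iterS -/(concat_pos _).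
by rewrite pos ?prednK// /concat_step/= prednK// ltnn.
Qed.

(** The walk replaces offset [L k] by offset [0] of block [k.+1]. As the two points agree, even the
    step across a joint is a step inside one block. *)
Lemma concat_seqS t : (forall k, c k (L k) = c k.+1 0%N) ->
  concat_seq t.+1 = c (concat_pos t).1 (concat_pos t).2.+1.
Proof.
move=> cL; rewrite /concat_seq {1 2}/concat_pos iterS -/(concat_pos t).
rewrite /concat_step; case: ltnP => //= Lle.
suff -> : (concat_pos t).2.+1 = L (concat_pos t).1 by rewrite cL.
by apply/eqP; rewrite eqn_leq concat_pos_lt.
Qed.

End concatenation.

Theorem lemma15 (R : realType) (X : metricType R) (f : X -> X) (Z : set X)
    (sepX : separable_space X) (fcont : continuous f) (Zne : Z !=set0)
    (Zclosed : closed Z) (Zict : internally_chain_transitive f Z) :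
  exists x : nat -> X,
    [/\ asymptotic_pseudo_orbit f x, forall i : nat, Z (x i) &
        omega_seq x = Z].
Proof.
have [z [Zz zfreq]] := separable_frequent_seq sepX Zne.
have /choice[C CP] : forall k, exists nc : nat * (nat -> X),
    delta_chain f k.+1%:R^-1 (z k) (z k.+1) nc.1 nc.2 /\
    forall i, (i <= nc.1)%N -> Z (nc.2 i).
  move=> k; have k0 : 0 < k.+1%:R^-1 :> R by rewrite invr_gt0 ltr0n.
  by have [n [c nc]] := Zict _ _ (Zz k) (Zz k.+1) _ k0; exists (n, c).
pose L k := (C k).1; pose c k := (C k).2.
have L0 k : (0 < L k)%N by have [[]] := CP k.
have c0 k : c k 0%N = z k by have [[]] := CP k.
have cL k : c k (L k) = c k.+1 0%N by rewrite c0; have [[]] := CP k.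
have cd k i : (i < L k)%N -> mdist (f (c k i)) (c k i.+1) < k.+1%:R^-1.
  by have [[_ _ _ cd] _] := CP k; exact: cd.
have Zc k i : (i < L k)%N -> Z (c k i) by move=> /ltnW; exact: (CP k).2.
pose x := concat_seq c L.
have Zx i : Z (x i) by apply: Zc; exact: concat_pos_lt.
exists x; split=> //.
- apply/cvgr0Pnorm_lt => e e0.
  have [K] := ltr_add_invr e0; rewrite add0r => Ke.
  (* From the start of block [K] on, all errors are below [1/(K+1)], hence below [e]. *)
  have [t0 _ t0K] := concat_pos_reach L0 K.
  exists t0 => // t /= t0t; rewrite ger0_norm ?mdist_ge0//.
  rewrite /x concat_seqS//; apply: lt_trans Ke.
  apply: lt_le_trans (cd _ _ (concat_pos_lt L0 t)) _.
  rewrite lef_pV2 ?posrE ?ltr0n// ler_nat ltnS.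
  by have := concat_pos_nondecreasing L t0t; rewrite t0K.
(* The tail from index [0] is enough for the first inclusion: all of [x] lies in the closed set
   [Z]. *)
- apply/seteqP; split=> [p /(_ 0%N I)|p Zp N _].
    rewrite [X in _ -> X p](proj1 (closure_id Z) Zclosed).
    by apply: closureS => _ [i _ <-].
  move=> B /nbhs_ballP[e /= e0 peB].
  (* The point [z k] is visited at a time [t >= k >= N], so inside the required tail. *)
  have [k Nk pk] := zfreq _ Zp _ e0 N.
  have [t kt tk] := concat_pos_reach L0 k.
  have xt : x t = z k by rewrite /x /concat_seq tk c0.
  exists (z k); split; first by exists t => //=; exact: leq_trans kt.
  by apply: peB; rewrite ballEmdist.
Qed.
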